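(* Let $m_1\geq\dots\geq m_t$ be positive integers and let $M_{m_1}^k,\dots,M_{m_t}^k$ be $k$-uniform matchings of sizes $m_1,\dots,m_t$. Then \[ \log_2\left(km_1+\sum_{i=2}^t(m_i-1)\right)\leq\operatorname{BR}^k(M_{m_1}^k,\dots,M_{m_t}^k)\leq\left\lceil\log_2\left(1+\sum_{i=1}^t(m_i-1)\right)\right\rceil+k-1. \]
   Context: A $k$-chain in a poset is a set of $k$ distinct pairwise comparable elements. A $k$-uniform pograph $H$ is a poset $(V(H),\le)$ with a set $E(H)$ of edges, each a $k$-chain. The $k$-uniform matching $M_m^k$ of size $m$ is the pograph whose poset is the disjoint union of $m$ chains of $k$ elements each (elements in different chains incomparable), with these $m$ chains as its edges. Given a coloring of the $k$-chains of a poset $Q$, a copy of $H$ in color $i$ is an injection $f:V(H)\to Q$ with $f(x)\le f(y)$ whenever $x\le y$, such that $f(e)$ has color $i$ for all $e\in E(H)$. $\operatorname{BR}^k(G_1,\dots,G_t)$ is the least $N$ such that every coloring of the $k$-chains of the Boolean lattice $B_N$ (subsets of $[N]$ under inclusion) with colors $\{1,\dots,t\}$ contains, for some $i$, a copy of $G_i$ in color $i$. *)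

(* Defs.v *)
From HB Require Import structures.
From mathcomp Require Import all_boot all_order all_algebra.
From mathcomp Require Import reals exp.

Set Implicit Arguments.
Unset Strict Implicit.
Unset Printing Implicit Defensive.

Import Order.TTheory GRing.Theory Num.Theory.
Import Order.DefaultSetSubsetOrder.
Local Open Scope order_scope.

Definition is_chain d (P : finPOrderType d) (k : nat) (A : {set P}) : bool :=
  (#|A| == k) && [forall x in A, forall y in A, x >=< y].

Definition chain d (P : finPOrderType d) (k : nat) : Type :=
  {A : {set P} | is_chain k A}.

Record pograph (k : nat) := Pograph {
  pg_display : Order.disp_t;
  pg_vertex : finPOrderType pg_display;
  pg_edge : {set chain pg_vertex k}
}.

(* The pair (c, a) is the a-th element, from the bottom, of the c-th chain. *)
Definition chains (m k : nat) : Type := ('I_m * 'I_k)%type.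

Section ChainsOrder.
Variables m k : nat.

HB.instance Definition _ := Finite.on (chains m k).

Definition chains_le (x y : chains m k) : bool :=
  (x.1 == y.1) && (x.2 <= y.2)%N.

Fact chains_display : Order.disp_t.
Proof. exact: Order.Disp tt tt. Qed.

Fact chains_le_refl : reflexive chains_le.
Proof. by move=> x; rewrite /chains_le eqxx leqnn. Qed.

Fact chains_le_anti : antisymmetric chains_le.
Proof.
move=> [c a] [d b]; rewrite /chains_le /=.
case/andP=> /andP[/eqP -> le_ab] /andP[_ le_ba].
by congr pair; apply/val_inj/eqP; rewrite eqn_leq le_ab.
Qed.

Fact chains_le_trans : transitive chains_le.
Proof.
move=> y x z /andP[/eqP xy1 xy2] /andP[/eqP yz1 yz2].
by rewrite /chains_le xy1 yz1 eqxx (leq_trans xy2 yz2).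
Qed.

HB.instance Definition _ := Order.Le_isPOrder.Build chains_display (chains m k)
  chains_le_refl chains_le_anti chains_le_trans.

End ChainsOrder.

Definition matching (k m : nat) : pograph k :=
  @Pograph k _ (chains m k)
    [set e : chain (chains m k) k |
      [exists c : 'I_m, val e == [set x : chains m k | x.1 == c]]].

(* The image of an edge under an injective monotone map is again a k-chain;
   the existential only produces this image as an element of [chain Q k]. *)
Definition is_copy k (H : pograph k) d (Q : finPOrderType d) (C : Type)
    (col : chain Q k -> C) (i : C) (f : pg_vertex H -> Q) : Prop :=
  [/\ injective f,
      {homo f : x y / x <= y} &
      forall e, e \in pg_edge H ->
        exists2 e' : chain Q k, val e' = f @: val e & col e' = i].

Definition boolean_lattice (N : nat) : finPOrderType _ := {set 'I_N}.

Definition boolean_arrows k t (G : 'I_t -> pograph k) (N : nat) : Prop :=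
  forall col : chain (boolean_lattice N) k -> 'I_t,
    exists i : 'I_t, exists f : pg_vertex (G i) -> boolean_lattice N,
      is_copy col i f.

Definition is_BR k t (G : 'I_t -> pograph k) (N : nat) : Prop :=
  boolean_arrows G N /\ forall N', boolean_arrows G N' -> (N <= N')%N.

Definition log2 (R : realType) (x : R) : R := (ln x / ln 2)%R.

(* Main.v *)
(** Upper bound: splitting [[n + k - 1]] into [[n]] and [k - 1] further points,
    the sets [A :|: C] with [A] in [B_n] and [C] in a maximal chain of
    [B_(k-1)] form [2^n] pairwise disjoint k-chains, and the pigeonhole
    principle applies to these chains alone.  Lower bound: if the poset has
    fewer than [k m_j + \sum_(i != j) (m_i - 1)] elements, label them so that
    label [j] is used less than [k m_j] times and every other label [i] at most
    [m_i - 1] times; give a chain the color of one of its labels other than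
    [j], and color [j] when there is none. *)
Require Import Defs.
From mathcomp Require Import all_boot all_order all_algebra.
From mathcomp Require Import boolp reals exp.
Local Open Scope ring_scope.

Set Implicit Arguments.
Unset Strict Implicit.
Unset Printing Implicit Defensive.

Import Order.TTheory GRing.Theory Num.Theory.
Import Order.DefaultSetSubsetOrder.

Lemma mono_chain_image d (Q : finPOrderType d) k (g : 'I_k -> Q) :
  injective g -> {homo g : a b / (a <= b)%N >-> (a <= b)%O} ->
  is_chain k [set g a | a : 'I_k].
Proof.
move=> g_inj g_mono; rewrite /is_chain card_imset // card_ord eqxx /=.
apply/forall_inP => _ /imsetP[a _ ->]; apply/forall_inP => _ /imsetP[b _ ->].
by case/orP: (leq_total a b) => /g_mono le_g; rewrite /Order.comparable le_g ?orbT.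
Qed.

Lemma chains_block_is_chain m k (c : 'I_m) :
  is_chain k [set x : chains m k | x.1 == c].
Proof.
have -> : [set x : chains m k | x.1 == c] = [set ((c, a) : chains m k) | a : 'I_k].
  apply/setP => -[c' a]; rewrite inE /=.
  apply/eqP/imsetP => [-> | [b _ [-> _]]] //; by exists a.
apply: mono_chain_image => [a b [] // | a b le_ab].
by rewrite /Order.le /= /chains_le /= eqxx.
Qed.

Definition block m k (c : 'I_m) : chain (chains m k) k :=
  exist (is_chain k) _ (chains_block_is_chain k c).

Lemma block_edge m k (c : 'I_m) : block k c \in pg_edge (matching k m).
Proof. by rewrite inE; apply/existsP; exists c. Qed.

(** If every fibre of [h] had fewer than [s j] elements, summing the fibre sizes would bound [#|I|]
    by the left-hand sum. Truncation in [s j - 1] is harmless: [s j = 0] makes the conclusion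
    immediate. *)
Lemma pigeonhole_weighted (I J : finType) (s : J -> nat) (h : I -> J) :
  (\sum_j (s j - 1) < #|I|)%N -> exists j, (s j <= #|[set x | h x == j]|)%N.
Proof.
move=> lt_sum; apply/existsP; apply: contraLR lt_sum.
rewrite negb_exists -leqNgt => /forallP small.
rewrite -sum1_card (partition_big h xpredT) //=.
apply: leq_sum => j _; rewrite sum1dep_card.
have := small j; rewrite -ltnNge => lt_s.
by rewrite leq_subRL ?add1n //; apply: leq_ltn_trans lt_s.
Qed.

(** [I] injects into a disjoint union of blocks of sizes [s j]; label each element by its block. *)
Lemma labelling_exists (I J : finType) (s : J -> nat) :
  (#|I| <= \sum_j s j)%N ->
  exists h : I -> J, forall j, (#|[set x | h x == j]| <= s j)%N.
Proof.
pose S := {j : J & 'I_(s j)}.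
have cardS : #|{: S}| = (\sum_j s j)%N.
  rewrite card_tagged sumnE big_map big_enum /=.
  by apply: eq_bigr => j _; rewrite card_ord.
rewrite -cardS => le_IS.
pose g (x : I) : S := enum_val (widen_ord le_IS (enum_rank x)).
have g_inj : injective g.
  by move=> x y /enum_val_inj /(congr1 val) /= /val_inj /enum_rank_inj.
exists (fun x => tag (g x)) => j.
rewrite -(card_imset _ g_inj) -[leqRHS]card_ord.
apply: leq_trans (leq_image_card (fun a : 'I_(s j) => Tagged (fun i => 'I_(s i)) a) _).
apply/subset_leq_card/subsetP => _ /imsetP[x + ->].
rewrite inE; case: (g x) => i a /= /eqP eq_ij; case: _ / eq_ij.
exact: codom_f.
Qed.

(** By pigeonhole some color [i] occurs on [m i] of the chains [g (c, _)]. Injectivity of [g] makes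
    them disjoint, so together they are the image of a matching; a copy may have comparabilities
    between different chains. *)
Lemma disjoint_chains_arrow d (Q : finPOrderType d) k t (m : 'I_t -> nat)
    (I : finType) (g : I * 'I_k -> Q) (col : chain Q k -> 'I_t) :
  injective g ->
  (forall c, {homo (fun a => g (c, a)) : a b / (a <= b)%N >-> (a <= b)%O}) ->
  (\sum_i (m i - 1) < #|I|)%N ->
  exists i, exists f : pg_vertex (matching k (m i)) -> Q, is_copy col i f.
Proof.
move=> g_inj g_mono lt_sum.
have chain_g c : is_chain k [set g (c, a) | a : 'I_k].
  by apply: mono_chain_image (g_mono c) => a b /g_inj[].
pose D c : chain Q k := exist (is_chain k) _ (chain_g c).
have [i le_mi] := pigeonhole_weighted (fun c => col (D c)) lt_sum.
pose e (c : 'I_(m i)) : I := enum_val (widen_ord le_mi c).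
have e_inj : injective e.
  by move=> c c' /enum_val_inj /(congr1 val) /= /val_inj.
have col_e c : col (D (e c)) = i.
  by have := enum_valP (widen_ord le_mi c); rewrite inE => /eqP.
exists i, (fun x => g (e x.1, x.2)); split.
- by move=> [c a] [c' a'] /g_inj[/e_inj -> ->].
- move=> [c a] [c' a']; rewrite {1}/Order.le /= /chains_le /=.
  by case/andP => /eqP <-; apply: g_mono.
move=> E; rewrite inE => /existsP[c /eqP E_c]; exists (D (e c)) => //=.
rewrite E_c; apply/setP => y; apply/imsetP/imsetP.
  by case=> a _ ->; exists (c, a); rewrite ?inE.
by case=> -[c' a]; rewrite inE /= => /eqP -> ->; exists a.
Qed.

Lemma arrow_card_lower_bound d (Q : finPOrderType d) k t (m : 'I_t -> nat)
    (j : 'I_t) :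
  (0 < k)%N -> (forall i, (0 < m i)%N) ->
  (forall col : chain Q k -> 'I_t, exists i,
     exists f : pg_vertex (matching k (m i)) -> Q, is_copy col i f) ->
  (k * m j + \sum_(i < t | i != j) (m i - 1) <= #|Q|)%N.
Proof.
move=> k_gt0 m_gt0 arrow; rewrite leqNgt; apply/negP => lt_Q.
have km_gt0 : (0 < k * m j)%N by rewrite muln_gt0 k_gt0 m_gt0.
(* Each capacity is one below what a copy in that color would force. Their sum is one less than the
   claimed bound, hence still at least [#|Q|]. *)
pose s i := if i == j then (k * m j).-1 else (m i - 1)%N.
have [|h card_h] := @labelling_exists Q _ s.
  rewrite (bigD1 j) //= /s eqxx (eq_bigr (fun i => m i - 1)%N); last first.
    by move=> i /negPf ->.
  by rewrite -ltnS -addSn prednK.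
pose col (e : chain Q k) : 'I_t :=
  if [pick x in val e | h x != j] is Some x then h x else j.
have [i [f [f_inj _ f_col]]] := arrow col.
have {f_col} col_block c :
    exists2 e : chain Q k, val e = f @: [set x : chains _ _ | x.1 == c] & col e = i.
  exact: f_col (block_edge k c).
have := card_h i; rewrite /s; case: eqP => [ij | /eqP ij].
  (* A picked label differs from [j], so an edge of color [j] carries only the label [j]. The edges
     cover all vertices, which puts [k * m j] points in class [j]. *)
  have all_j x : h (f x) = j.
    have [e def_e] := col_block x.1; rewrite /col; case: pickP => [y | none _].
      by case/andP=> _ /negPf h_y; rewrite ij => /eqP; rewrite h_y.
    by have := none (f x); rewrite def_e imset_f ?inE //= => /negbFE/eqP.
  apply/negP; rewrite -ltnNge prednK //.
  rewrite -ij mulnC -{1}(card_ord (m i)) -{1}(card_ord k) -card_prod.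
  rewrite -(card_codom f_inj); apply/subset_leq_card/subsetP => _ /codomP[x ->].
  by rewrite inE all_j ij.
(* A color other than [j] can only be the label of a picked vertex. One such vertex from each of the
   disjoint edges gives [m i] points labelled [i]. *)
have has_i c : exists a : 'I_k, h (f (c, a)) == i.
  have [e def_e] := col_block c; rewrite /col; case: pickP => [y | _ eq_ji].
    rewrite def_e => /andP[/imsetP[[c' a]]]; rewrite inE /= => /eqP -> -> _ eq_i.
    by exists a; apply/eqP.
  by case/eqP: ij.
pose r c := f (c, xchoose (has_i c)).
have r_inj : injective r by move=> c c' /f_inj[].
apply/negP; rewrite -ltnNge subn1 prednK //.
rewrite -{1}(card_ord (m i)) -(card_codom r_inj).
apply/subset_leq_card/subsetP => _ /codomP[c ->].
by rewrite inE (xchooseP (has_i c)).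
Qed.

Lemma boolean_arrows_upper n k t (m : 'I_t -> nat) :
  (0 < k)%N -> (\sum_i (m i - 1) < 2 ^ n)%N ->
  boolean_arrows (fun i => matching k (m i)) (n + k.-1).
Proof.
move=> k_gt0 lt_sum col.
(* [g (A, a)] is [A] together with the first [a] of the [k.-1] extra points; [a] runs from 0 to
   [k.-1], giving [k] sets for each [A]. *)
pose g (x : {set 'I_n} * 'I_k) : boolean_lattice (n + k.-1) :=
  [set z | match split z with inl y => y \in x.1 | inr y => (y < x.2)%N end].
have g_l x y : (lshift k.-1 y \in g x) = (y \in x.1).
  by rewrite inE (unsplitK (inl y)).
have g_r x y : (rshift n y \in g x) = (y < x.2)%N.
  by rewrite inE (unsplitK (inr y)).
(* Otherwise the extra point of index [x'.2] lies in [g x] but not in [g x']. *)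
have le_of_g x x' : g x = g x' -> (x.2 <= x'.2)%N.
  move=> eq_g; rewrite leqNgt; apply/negP => lt_x.
  have lt_k : (x'.2 < k.-1)%N by rewrite (leq_trans lt_x) // -ltnS prednK.
  by have := g_r x (Ordinal lt_k); rewrite eq_g g_r /= ltnn lt_x.
apply: (@disjoint_chains_arrow _ _ _ _ _ _ g).
- move=> x x' eq_g; rewrite [x]surjective_pairing [x']surjective_pairing.
  congr pair; first by apply/setP => y; rewrite -!g_l eq_g.
  by apply/val_inj/eqP; rewrite eqn_leq !le_of_g.
- move=> A a b le_ab; apply/subsetP => z; rewrite !inE.
  by case: (split z) => //= y lt_y; apply: leq_trans le_ab.
by rewrite -cardsT -powersetT card_powerset cardsT card_ord.
Qed.

Lemma log2_exp (R : realType) n : log2 ((2 ^ n)%N%:R : R) = n%:R.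
Proof.
have ln2 : ln (2 : R) != 0 by rewrite gt_eqF // ln_gt0 // ltr1n.
by rewrite /log2 natrX lnXn // -[_ *+ n]mulr_natl mulfK.
Qed.

Lemma ler_log2 (R : realType) :
  {in Num.pos &, {mono @log2 R : x y / x <= y}}.
Proof.
move=> x y x_gt0 y_gt0; rewrite /log2 ler_pM2r ?ler_ln //.
by rewrite invr_gt0 ln_gt0 // ltr1n.
Qed.

Lemma ler_log2_nat (R : realType) (a n : nat) : (0 < a)%N ->
  (log2 (a%:R : R) <= n%:R) = (a <= 2 ^ n)%N.
Proof.
move=> a_gt0.
by rewrite -(log2_exp R n) ler_log2 ?ler_nat // posrE ltr0n ?expn_gt0.
Qed.

Theorem theorem3p3 (R : realType) (k t : nat) (k_gt0 : (0 < k)%N)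
    (t_gt0 : (0 < t)%N) (m : 'I_t -> nat)
    (m_gt0 : forall i, (0 < m i)%N)
    (m_noninc : forall i j : 'I_t, (i <= j)%N -> (m j <= m i)%N) :
  exists N : nat,
    [/\ is_BR (fun i => matching k (m i)) N,
        log2 ((k * m (Ordinal t_gt0) + \sum_(i < t | 0 < i) (m i - 1))%N%:R : R)
          <= N%:R &
        N%:Z <= Num.ceil (log2 ((1 + \sum_(i < t) (m i - 1))%N%:R : R))
                + k%:Z - 1].
Proof.
set S := (\sum_(i < t) (m i - 1))%N.
have log_ge0 : 0 <= log2 ((1 + S)%N%:R : R).
  by rewrite -[leLHS](log2_exp R 0) ler_log2 ?ler_nat // posrE ltr0n.
(* The logarithm is nonnegative, so its ceiling is a natural number, the dimension [n] for the upper
   bound. *)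
have [n def_n] : exists n : nat, Num.ceil (log2 ((1 + S)%N%:R : R)) = n%:Z.
  exists `|Num.ceil (log2 ((1 + S)%N%:R : R))|%N.
  by rewrite gez0_abs // -(ceil0 R) le_ceil.
have lt_S : (S < 2 ^ n)%N.
  rewrite -[leqLHS]add1n -(ler_log2_nat R) //.
  by rewrite -[leRHS]/((n%:Z)%:~R) -def_n ceil_ge.
have arrows_n := boolean_arrows_upper k_gt0 lt_S.
pose P N := `[< boolean_arrows (fun i => matching k (m i)) N >].
have exP : exists N, P N by exists (n + k.-1)%N; apply/asboolP.
case: (ex_minnP exP) => N /asboolP arrows_N min_N; exists N; split.
- by split=> // N' arrows_N'; apply/min_N/asboolP.
- rewrite ler_log2_nat ?addn_gt0 ?muln_gt0 ?k_gt0 ?m_gt0 //.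
  (* [B_N] has [2 ^ N] elements, and with [j] the first index the remaining sum runs over
     [0 < i]. *)
  have := arrow_card_lower_bound (Ordinal t_gt0) k_gt0 m_gt0 arrows_N.
  rewrite -cardsT -powersetT card_powerset cardsT card_ord.
  by rewrite (eq_bigl (fun i : 'I_t => 0 < i)%N) // => i; rewrite -lt0n.
have := min_N _ (asboolT arrows_n).
by rewrite def_n -{2}(prednK k_gt0) -addn1 !PoszD addrA addrK -PoszD lez_nat.
Qed.
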